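(* Let $\mathbf M:S\to\mathbb R^{n\times n}$ satisfy (C0)–(C3) and the stronger condition (C2'), and let $\mathbf M$ be induced by $h\in C^2(\mathrm{int}(S))$, i.e. $\mathbf M(z)=(\nabla_z^2h(z))^{-1}$ for all $z\in\mathrm{int}(S)$. For $\alpha,\tilde\varepsilon>0$ and $g\in C_c^\infty(\mathrm{int}(S))$ define $f(z):=\alpha h(z)+\tilde\varepsilon g(z)$ and $\mathbf L(z):=\mathbf M(z)\nabla_z^2f(z)$. Then, for $\tilde\varepsilon>0$ sufficiently small (given $\alpha$, $g$, $\mathbf M$), the generalized McCann condition is satisfied: for all $z\in\mathrm{int}(S)$ and all $v,\zeta,\beta\in\mathbb R^n$ (omitting the argument $z$ of $\mathbf M$ and $\mathbf L$), $$\begin{aligned}0\le{}&-\tfrac12v^{\mathrm T}\,\mathrm D^2\mathbf M[\zeta,\mathbf L\zeta]\,v+\beta^{\mathrm T}\mathbf L\mathbf M\beta+\beta^{\mathrm T}\big(\mathbf L\,\mathrm D\mathbf M[\zeta]-\mathrm D\mathbf M[\mathbf L\zeta]\big)v\\&+v^{\mathrm T}\,\mathrm D\mathbf L[\zeta]\big(\mathrm D\mathbf M[\zeta]v+\mathbf M\beta\big)-v^{\mathrm T}\,\mathrm D\mathbf L\big[\mathrm D\mathbf M[\zeta]v+\mathbf M\beta\big]\zeta .\end{aligned}$$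
   Context: $S\subset\mathbb R^n$ is convex and compact with nonempty interior. Conditions: (C0) $\mathbf M$ is continuous on $S$ and smooth on $\mathrm{int}(S)$; (C1) $\mathbf M(z)$ is symmetric positive definite for each $z\in\mathrm{int}(S)$; (C2) $\mathrm D^2\mathbf M(z)[\zeta,\zeta]$ is negative semidefinite for each $z\in\mathrm{int}(S)$, $\zeta\in\mathbb R^n$; (C2') $\mathrm D^2\mathbf M(z)[\zeta,\zeta]$ is negative definite for all $z\in\mathrm{int}(S)$ and $\zeta\in\mathbb R^n\setminus\{0\}$; (C3) $\mathbf M(z)\nu=0$ if $z\in\partial S$ and $\nu$ is a normal vector to $\partial S$ at $z$. $\mathrm D$ with square brackets denotes directional derivatives with respect to $z$: $\mathrm D\mathbf M(z)[\zeta]=\frac{d}{ds}|_{s=0}\mathbf M(z+s\zeta)$, and $\mathrm D^2\mathbf M(z)[\zeta,\tilde\zeta]$ is the symmetric bilinear second derivative. *)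

(* Defs.v *)
From HB Require Import structures.
From mathcomp Require Import all_boot all_order all_algebra.
From mathcomp Require Import all_classical all_reals.
From mathcomp Require Import topology normedtype derive convex.
Set Implicit Arguments.
Unset Strict Implicit.
Unset Printing Implicit Defensive.
Import Order.TTheory GRing.Theory Num.Theory.
Import numFieldNormedType.Exports.
Local Open Scope classical_set_scope.
Local Open Scope ring_scope.

(* Maps on a subset of R^n = 'cV[R]_n are represented by total functions on
   'cV[R]_n; below, only their values on that subset matter. *)

(* The derivative of order k exists on U and is continuous there. In finite
   dimension, f is C^(k+1) iff it is differentiable and z |-> Df(z)[v] is C^k
   for each fixed direction v. U is meant to be open. *)
Fixpoint Ck (R : realType) (V W : normedModType R) (k : nat)
    (U : set V) (f : V -> W) : Prop :=
  if k is k'.+1 then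
    (forall z, U z -> differentiable f z) /\
    (forall v : V, Ck k' U (fun z => 'D_v f z))
  else forall z, U z -> {for z, continuous f}.

Definition smooth (R : realType) (V W : normedModType R)
    (U : set V) (f : V -> W) : Prop := forall k, Ck k U f.

Section Notions.
Context {R : realType} {n : nat}.
Implicit Types (S U : set 'cV[R]_n) (M L : 'cV[R]_n -> 'M[R]_n).

Definition dot (x y : 'cV[R]_n) : R := (x^T *m y) 0 0.

(* The closure makes this independent of the values of g outside U. *)
Definition smooth_compact_support U (g : 'cV[R]_n -> R) : Prop :=
  [/\ smooth U g,
      compact (closure (U `&` [set z | g z != 0])) &
      closure (U `&` [set z | g z != 0]) `<=` U].

Definition D2 M (z x y : 'cV[R]_n) : 'M[R]_n := 'D_y (fun w => 'D_x M w) z.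

Definition hessian (h : 'cV[R]_n -> R) (z : 'cV[R]_n) : 'M[R]_n :=
  \matrix_(i, j) 'D_(delta_mx j 0) (fun w => 'D_(delta_mx i 0) h w) z.

Definition posdef (A : 'M[R]_n) : Prop :=
  forall v : 'cV[R]_n, v != 0 -> 0 < dot v (A *m v).
Definition negdef (A : 'M[R]_n) : Prop :=
  forall v : 'cV[R]_n, v != 0 -> dot v (A *m v) < 0.
Definition negsemidef (A : 'M[R]_n) : Prop :=
  forall v : 'cV[R]_n, dot v (A *m v) <= 0.

Definition boundary S : set 'cV[R]_n := closure S `\` S°.

(* Element of the normal cone of the convex set S at z; the boundary of S need
   not be smooth. *)
Definition normal_vector S (z nu : 'cV[R]_n) : Prop :=
  forall y, S y -> dot nu (y - z) <= 0.

Definition condC0 S M : Prop := {within S, continuous M} /\ smooth S° M.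
Definition condC1 S M : Prop :=
  forall z, S° z -> (M z)^T = M z /\ posdef (M z).
Definition condC2 S M : Prop :=
  forall z, S° z -> forall zeta, negsemidef (D2 M z zeta zeta).
Definition condC2' S M : Prop :=
  forall z, S° z -> forall zeta, zeta != 0 -> negdef (D2 M z zeta zeta).
Definition condC3 S M : Prop :=
  forall z nu, boundary S z -> normal_vector S z nu -> M z *m nu = 0.

(* Invertibility is stated because invmx A = A when A is singular. *)
Definition induced_by S M (h : 'cV[R]_n -> R) : Prop :=
  forall z, S° z -> hessian h z \in unitmx /\ M z = invmx (hessian h z).

Definition generalized_mccann S M L : Prop :=
  forall z, S° z -> forall v zeta beta : 'cV[R]_n,
  let Mz := M z in
  let Lz := L z in
  let DM x := 'D_x M z in
  let DL x := 'D_x L z in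
  0 <= - 2%:R^-1 * dot v (D2 M z zeta (Lz *m zeta) *m v)
       + dot beta (Lz *m Mz *m beta)
       + dot beta ((Lz *m DM zeta - DM (Lz *m zeta)) *m v)
       + dot v (DL zeta *m (DM zeta *m v + Mz *m beta))
       - dot v (DL (DM zeta *m v + Mz *m beta) *m zeta).

End Notions.

(* Main.v *)
Require Import Defs.
From mathcomp Require Import all_boot all_order all_algebra.
From mathcomp Require Import all_classical all_reals.
From mathcomp Require Import topology normedtype derive convex.
From mathcomp Require Import ring lra.
Set Implicit Arguments.
Unset Strict Implicit.
Unset Printing Implicit Defensive.
Import Order.TTheory GRing.Theory Num.Theory.
Import numFieldNormedType.Exports.
Local Open Scope classical_set_scope.
Local Open Scope ring_scope.

(** Write [N z := M z *m hessian g z].  Because [M] inverts the Hessian of [h],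
    [L = alpha I + eps N] on the interior of [S].  The McCann expression is
    affine in [L] (counting [DL] with it), and the part that comes from
    [alpha I] collapses, since [D(alpha I) = 0] and
    [alpha DM[zeta] - DM[alpha zeta] = 0], to
      alpha (- 1/2 v^T D^2 M[zeta, zeta] v + beta^T M beta),
    whose two terms are nonnegative by concavity and positivity of [M].  The
    remaining part is [eps] times the same expression with [N] in place of [L].

    Off the support [K] of [g] the matrix [N] vanishes near [z], so only the
    [alpha] part is left.  On the compact set [K] both parts are compared with
    [W := (|v| |zeta| + |beta|)^2].  A continuous family of positive definite
    matrices over a compact set is uniformly so ([uniform_posdef]); this applies
    to [M] over [K], and to [- D^2 M[zeta, zeta]] over the product of [K] with
    the unit sphere ([uniform_negdef_D2]), where strict concavity enters.  Hence
    the [alpha] part is at least a positive multiple of [W].  Each term of the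
    [eps] part is multilinear in copies of [v], [zeta] and [beta], with
    coefficients that are bounded on [K], so it is at most a constant times [W]
    ([dominated_mccann_form]).  A small [eps] makes the first part win.  The
    constants involve [M] and [g] alone, which is why the threshold can be
    chosen before [h]. *)

(** * Sup norms of matrices *)

Section MatrixNorm.
Context {R : realType}.

Lemma mx_norm_leP m n (A : 'M[R]_(m, n)) (e : R) : 0 <= e ->
  reflect (forall i j, `|A i j| <= e) (`|A| <= e).
Proof.
move=> e0; rewrite [leLHS]/Num.Def.normr/= mx_normrE.
apply: (iffP (bigmax_leP _ _ _ _)) => [[_ Ae] i j|Ae]; first exact: (Ae (i, j)).
by split.
Qed.

Lemma entry_norm_le m n (A : 'M[R]_(m, n)) i j : `|A i j| <= `|A|.
Proof. exact: (mx_norm_leP A (normr_ge0 A)). Qed.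

Lemma norm_trmx m n (A : 'M[R]_(m, n)) : `|A^T| = `|A|.
Proof.
apply/eqP; rewrite eq_le; apply/andP; split; apply/mx_norm_leP => // i j.
  by rewrite mxE entry_norm_le.
by rewrite -[A]trmxK mxE trmxK entry_norm_le.
Qed.

Lemma norm_mulmx_le m n p (A : 'M[R]_(m, n)) (B : 'M[R]_(n, p)) :
  `|A *m B| <= n%:R * (`|A| * `|B|).
Proof.
apply/mx_norm_leP => [|i j]; first by rewrite !mulr_ge0.
rewrite mxE (le_trans (ler_norm_sum _ _ _))//.
rewrite -[X in X%:R * _](card_ord n) mulr_natl -sumr_const ler_sum// => k _.
by rewrite normrM ler_pM// entry_norm_le.
Qed.

Lemma colE_sum_delta n (x : 'cV[R]_n) :
  x = \sum_i x i 0 *: (delta_mx i 0 : 'cV[R]_n).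
Proof.
by rewrite {1}(matrix_sum_delta x); apply: eq_bigr => i _; rewrite big_ord1.
Qed.

End MatrixNorm.

(** * Continuity and bounds on compact sets *)

Section Continuity.
Context {R : realType} {T : topologicalType}.

Lemma cvg_sumv (V : normedModType R) (F : set_system T) {FF : Filter F}
    (I : Type) (r : seq I) (f : I -> T -> V) (a : I -> V) :
  (forall i, f i t @[t --> F] --> a i) ->
  \sum_(i <- r) f i t @[t --> F] --> \sum_(i <- r) a i.
Proof. by move=> fa; apply: cvg_big => //; exact: add_continuous. Qed.

Lemma cvg_mxP m n (F : set_system T) {FF : Filter F} (A : T -> 'M[R]_(m, n))
    (B : 'M[R]_(m, n)) :
  A t @[t --> F] --> B <-> forall i j, A t i j @[t --> F] --> B i j.
Proof.
split=> [AB i j|AB].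
  exact: (cvg_comp _ (fun M : 'M[R]_(m, n) => M i j) AB
    (@coord_continuous _ _ _ i j B)).
rewrite (matrix_sum_delta B).
have -> : A = fun t => \sum_i \sum_j A t i j *: delta_mx i j.
  by apply/funext => t; exact: matrix_sum_delta.
by apply: cvg_sumv => i; apply: cvg_sumv => j; apply: cvgZr_tmp; exact: AB.
Qed.

Lemma compact_lower_bound (A : set T) (f : T -> R) : compact A ->
  {in A, continuous f} -> (forall t, A t -> 0 < f t) ->
  exists2 c, 0 < c & forall t, A t -> c <= f t.
Proof.
move=> cA cf f0; have [->|/set0P A0] := eqVneq A set0; first by exists 1.
have [t tA tmin] := compact_EVT_min A0 cA (continuous_in_subspaceT cf).
by exists (f t) => [|u Au]; [exact/f0/set_mem|exact/tmin/mem_set].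
Qed.

Lemma compact_norm_bound (V : normedModType R) (A : set T) (f : T -> V) :
  compact A -> {in A, continuous f} ->
  exists2 C, 0 <= C & forall t, A t -> `|f t| <= C.
Proof.
move=> cA cf.
have /compact_bounded/ex_strict_bound_gt0[C C0 fC] :=
  continuous_compact (continuous_in_subspaceT cf) cA.
by exists C; [exact: ltW|move=> t At; apply/ltW/fC; exists t].
Qed.

End Continuity.

Section Sphere.
Context {R : realType} {n : nat}.

(** Transposition is continuous and preserves the norm, so Heine-Borel for row
    vectors carries over. *)
Lemma compact_sphere : compact [set v : 'cV[R]_n | `|v| = 1].
Proof.
have -> : [set v : 'cV[R]_n | `|v| = 1] = trmx @` [set u : 'rV[R]_n | `|u| = 1].
  apply/seteqP; split=> [v v1|_ [u u1 <-]] /=; last by rewrite norm_trmx.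
  by exists v^T; [rewrite /= norm_trmx|rewrite trmxK].
apply: continuous_compact.
  apply: continuous_in_subspaceT => u _; apply/(cvg_mxP (F := nbhs u)) => i j.
  under eq_fun do rewrite mxE; rewrite mxE; exact: coord_continuous.
apply: bounded_closed_compact.
  by exists 1; split=> // x x1 u /= ->; exact: ltW.
rewrite (_ : mkset _ = Num.norm @^-1` [set 1 : R]) //.
apply: preimage_closed; last exact: closed_eq.
by move=> u _; exact: norm_continuous.
Qed.

(** [v^T Q(t) v] has a positive minimum on the product of [A] with the unit
    sphere; other vectors follow by scaling.  The parameter space is left
    general so that it can itself contain a sphere of directions. *)
Lemma uniform_posdef (T : topologicalType) (A : set T) (Q : T -> 'M[R]_n) :
  compact A -> {in A, continuous Q} -> (forall t, A t -> posdef (Q t)) ->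
  exists2 c, 0 < c &
    forall t, A t -> forall v, c * `|v| ^+ 2 <= dot v (Q t *m v).
Proof.
move=> cA cQ Qpos.
pose f (p : T * 'cV[R]_n) := dot p.2 (Q p.1 *m p.2).
have [p|p [Ap p1]|c c0 cf] :=
    @compact_lower_bound R _ _ f (compact_setX cA compact_sphere).
- rewrite inE => -[Ap p1].
  rewrite /f /dot /continuous_at; under eq_fun do rewrite mxE; rewrite mxE.
  have cfst : q.1 @[q --> p] --> p.1 by exact: cvg_fst.
  have csnd : q.2 @[q --> p] --> p.2 by exact: cvg_snd.
  apply: cvg_sumv => i; apply: cvgM.
    under eq_fun do rewrite mxE; rewrite mxE.
    exact: (cvg_mxP _ _).1 csnd _ _.
  under eq_fun do rewrite mxE; rewrite mxE; apply: cvg_sumv => j; apply: cvgM.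
    apply: (cvg_comp _ (fun t => Q t i j) cfst).
    by move/cvg_mxP : (cQ _ (mem_set Ap)); exact.
  exact: (cvg_mxP _ _).1 csnd _ _.
- by apply: Qpos => //; rewrite -normr_gt0 p1.
exists c => // t At v; have [->|v0] := eqVneq v 0.
  by rewrite normr0 expr0n/= mulr0 /dot trmx0 mul0mx mxE.
have v_gt0 : 0 < `|v| by rewrite normr_gt0.
have -> : dot v (Q t *m v) = f (t, `|v|^-1 *: v) * `|v| ^+ 2.
  rewrite /f /dot /= linearZ/= -scalemxAr -scalemxAr -scalemxAl !mxE.
  by field; rewrite gt_eqF.
rewrite ler_pM2r ?exprn_gt0//; apply: cf; split => //=.
by rewrite normrZ normfV normr_id mulVf ?gt_eqF.
Qed.

End Sphere.

(** * Directional derivatives *)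

Section Derivatives.
Context {R : realType} {n : nat}.
Local Notation V := 'cV[R]_n.
Implicit Types (U : set V) (z x y : V).

Lemma derive_coord (W : normedModType R) (f : V -> W) z x :
  differentiable f z ->
  'D_x f z = \sum_i x i 0 *: 'D_(delta_mx i 0 : V) f z.
Proof.
move=> df; rewrite deriveE// {1}[x]colE_sum_delta linear_sum.
by apply: eq_bigr => i _; rewrite linearZ/= -deriveE.
Qed.

Lemma derive_linear (W : normedModType R) (f : V -> W) z (a b : R) x y :
  differentiable f z -> 'D_(a *: x + b *: y) f z = a *: 'D_x f z + b *: 'D_y f z.
Proof. by move=> df; rewrite !deriveE// linearD !linearZ. Qed.

Lemma open_eq_derive (W : normedModType R) U (f g : V -> W) z x :
  open U -> U z -> (forall w, U w -> f w = g w) -> 'D_x f z = 'D_x g z.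
Proof.
move=> oU Uz fg; apply: near_eq_derive.
by apply: filterS (open_nbhs_nbhs (conj oU Uz)).
Qed.

Lemma Ck_continuous (W : normedModType R) k U (f : V -> W) :
  Ck k U f -> {in U, continuous f}.
Proof.
case: k => [|k] cf z; first by move=> /set_mem Uz; exact: cf.
by move=> /set_mem Uz; apply: differentiable_continuous; exact: cf.1.
Qed.

Lemma CkW (W : normedModType R) k U (f : V -> W) : Ck k.+1 U f -> Ck k U f.
Proof.
elim: k f => [|k IH] f [df Cf].
  by move=> z Uz; exact/differentiable_continuous/df.
by split=> // v; exact/IH/Cf.
Qed.

Lemma Ck_derivable (W : normedModType R) k U (f : V -> W) z x :
  Ck k.+1 U f -> U z -> derivable f z x.
Proof. by case=> df _ Uz; exact/diff_derivable/df. Qed.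

(** Bilinearity of the second derivative.  The expansion in [x] is only valid
    on [U], so it is substituted under the outer derivative by locality. *)
Lemma D2_coord U (M : V -> 'M[R]_n) z x y : open U -> Ck 2 U M -> U z ->
  D2 M z x y =
  \sum_i \sum_j (x i 0 * y j 0) *: D2 M z (delta_mx i 0) (delta_mx j 0).
Proof.
move=> oU [dM C1M] Uz; rewrite /D2.
rewrite (open_eq_derive (g := \sum_i x i 0 *: 'D_(delta_mx i 0 : V) M) y oU Uz).
  rewrite derive_sum => [|i]; last first.
    exact/derivableZ/(Ck_derivable (k := 0) (C1M _) Uz).
  apply: eq_bigr => i _; rewrite deriveZ; last first.
    exact: (Ck_derivable (k := 0) (C1M _) Uz).
  rewrite (derive_coord y ((C1M _).1 _ Uz)) scaler_sumr.
  by apply: eq_bigr => j _; rewrite scalerA.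
by move=> w /dM dMw; rewrite derive_coord// fct_sumE.
Qed.

Lemma is_derive_mulmx (m p q : nat) (A : V -> 'M[R]_(m, p))
    (B : V -> 'M[R]_(p, q)) z x : derivable A z x -> derivable B z x ->
  is_derive z x (fun w => A w *m B w) ('D_x A z *m B z + A z *m 'D_x B z).
Proof.
move=> dA dB.
have dAij i j : derivable (fun w => A w i j) z x.
  exact: ((derivable_mxP _ _ _).1 dA).
have dBij i j : derivable (fun w => B w i j) z x.
  exact: ((derivable_mxP _ _ _).1 dB).
have Eij i j : (fun w => (A w *m B w) i j) =
    \sum_k ((fun w => A w i k) * (fun w => B w k j)).
  by apply/funext => w; rewrite mxE fct_sumE.
have dAB : derivable (fun w => A w *m B w) z x.
  apply/(derivable_mxP _ _ _).2 => i j; rewrite Eij.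
  by apply: derivable_sum => k; exact: derivableM.
apply: DeriveDef => //; rewrite derive_mx//; apply/matrixP => i j.
rewrite mxE Eij derive_sum; last by move=> k; exact: derivableM.
rewrite !mxE -big_split/=; apply: eq_bigr => k _.
rewrite deriveM// (derive_mx dA) (derive_mx dB) !mxE addrC.
by congr (_ + _); exact: mulrC.
Qed.

Lemma linear_comb_mxE m p (A B : 'M[R]_(m, p)) (a b : R) i j :
  (a *: A + b *: B) i j = a * A i j + b * B i j.
Proof. by rewrite !mxE. Qed.

Lemma hessianE (h : V -> R) z i j :
  hessian h z i j = 'D_(delta_mx j 0) (fun w => 'D_(delta_mx i 0) h w) z.
Proof. by rewrite mxE. Qed.

Lemma hessian_entryE (h : V -> R) i j :
  (fun z => hessian h z i j) = 'D_(delta_mx j 0) ('D_(delta_mx i 0) h).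
Proof. by apply/funext => z; exact: hessianE. Qed.

Lemma derivable_hessian U (g : V -> R) z x :
  Ck 3 U g -> U z -> derivable (hessian g) z x.
Proof.
move=> Cg Uz; apply/(derivable_mxP _ _ _).2 => i j.
rewrite hessian_entryE; exact: (Ck_derivable (k := 0) ((Cg.2 _).2 _) Uz).
Qed.

Lemma hessian_comb U (h g : V -> R) (a b : R) z :
  open U -> Ck 2 U h -> Ck 2 U g -> U z ->
  hessian (fun w => a * h w + b * g w) z = a *: hessian h z + b *: hessian g z.
Proof.
move=> oU [dh C1h] [dg C1g] Uz; apply/matrixP => i j.
rewrite [RHS]linear_comb_mxE [LHS]hessianE.
transitivity (a * 'D_(delta_mx j 0) ('D_(delta_mx i 0) h) z +
              b * 'D_(delta_mx j 0) ('D_(delta_mx i 0) g) z); last first.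
  by congr (a * _ + b * _); apply/esym; exact: hessianE.
have comb (u v : V -> R) w y : derivable u w y -> derivable v w y ->
    'D_y (fun w => a * u w + b * v w) w = a * 'D_y u w + b * 'D_y v w.
  move=> du dv; rewrite -[fun w => _]/((a *: u) + (b *: v)).
  rewrite deriveD; [|exact: derivableZ|exact: derivableZ].
  by rewrite (deriveZ _ du) (deriveZ _ dv).
rewrite -comb; [|exact: (Ck_derivable (k := 0) (C1h _) Uz)|exact: (Ck_derivable (k := 0) (C1g _) Uz)].
apply: (open_eq_derive _ oU Uz) => w Uw.
by rewrite comb//; [exact/diff_derivable/dh|exact/diff_derivable/dg].
Qed.

Lemma hessian_eq0 U (g : V -> R) z :
  open U -> U z -> (forall w, U w -> g w = 0) -> hessian g z = 0.
Proof.
move=> oU Uz g0; apply/matrixP => i j; rewrite hessianE [RHS]mxE.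
rewrite (open_eq_derive (g := cst 0) _ oU Uz) ?derive_cst// => w Uw.
by rewrite (open_eq_derive (g := cst 0) _ oU Uw) ?derive_cst.
Qed.

End Derivatives.

(** * Uniform bounds by a weight *)

Section Domination.
Context {R : realType} {n : nat} (K : set 'cV[R]_n) {P : Type}.
Local Notation V := 'cV[R]_n.
Implicit Types (w : P -> R).

(** A calculus for multilinear estimates: [p] collects the vectors on which a
    quantity depends, and [w p] records its homogeneity in them.  The constant
    is uniform over [K], so products multiply the weights and the constants
    never have to be named. *)
Definition dominated (W : normedModType R) (F : V -> P -> W) w :=
  exists2 C : R, 0 <= C & forall z, K z -> forall p, `|F z p| <= C * w p.

Lemma dominated_le (W : normedModType R) (F : V -> P -> W) w w' :
  (forall p, w p <= w' p) -> dominated F w -> dominated F w'.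
Proof.
move=> ww' [C C0 FC]; exists C => // z Kz p.
by rewrite (le_trans (FC z Kz p))// ler_wpM2l.
Qed.

Lemma eq_dominated (W : normedModType R) (F G : V -> P -> W) w :
  (forall z, K z -> forall p, F z p = G z p) -> dominated F w -> dominated G w.
Proof.
by move=> FG [C C0 FC]; exists C => // z Kz p; rewrite -FG// FC.
Qed.

Lemma dominated_weightM1 (W : normedModType R) (F : V -> P -> W) w :
  dominated F (fun p => w p * 1) -> dominated F w.
Proof. by apply: dominated_le => p; rewrite mulr1. Qed.

Lemma dominated_weight1M (W : normedModType R) (F : V -> P -> W) w :
  dominated F (fun p => 1 * w p) -> dominated F w.
Proof. by apply: dominated_le => p; rewrite mul1r. Qed.

Lemma dominatedD (W : normedModType R) (F G : V -> P -> W) w :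
  dominated F w -> dominated G w -> dominated (fun z p => F z p + G z p) w.
Proof.
move=> [C C0 FC] [D D0 GD]; exists (C + D) => [|z Kz p]; first exact: addr_ge0.
by rewrite (le_trans (ler_normD _ _))// mulrDl lerD ?FC ?GD.
Qed.

Lemma dominatedN (W : normedModType R) (F : V -> P -> W) w :
  dominated F w -> dominated (fun z p => - F z p) w.
Proof. by move=> [C C0 FC]; exists C => // z Kz p; rewrite normrN FC. Qed.

Lemma dominated_sum (W : normedModType R) (I : Type) (r : seq I)
    (F : I -> V -> P -> W) w :
  (forall p, 0 <= w p) -> (forall i, dominated (F i) w) ->
  dominated (fun z p => \sum_(i <- r) F i z p) w.
Proof.
move=> w0 FC; elim: r => [|i r IH].
  by exists 0 => // z _ p; rewrite big_nil normr0 mul0r.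
have [C C0 FC'] := dominatedD (FC i) IH.
by exists C => // z Kz p; rewrite big_cons FC'.
Qed.

Lemma dominatedZ (W : normedModType R) (f : V -> P -> R) (F : V -> P -> W) w w' :
  dominated f w -> dominated F w' ->
  dominated (fun z p => f z p *: F z p) (fun p => w p * w' p).
Proof.
move=> [C C0 fC] [D D0 FD]; exists (C * D) => [|z Kz p]; first exact: mulr_ge0.
by rewrite normrZ mulrACA ler_pM ?fC ?FD.
Qed.

Lemma dominated_cst (W : normedModType R) (a : W) :
  dominated (fun _ _ => a) (fun=> 1).
Proof. by exists `|a| => // z _ p; rewrite mulr1. Qed.

Lemma dominated_continuous (W : normedModType R) (F : V -> W) :
  compact K -> {in K, continuous F} -> dominated (fun z _ => F z) (fun=> 1).
Proof.
move=> cK cF; have [C C0 FC] := compact_norm_bound cK cF.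
by exists C => // z Kz p; rewrite mulr1 FC.
Qed.

Lemma dominated_entry a b (F : V -> P -> 'M[R]_(a, b)) w i j :
  dominated F w -> dominated (fun z p => F z p i j) w.
Proof.
move=> [C C0 FC]; exists C => // z Kz p.
exact: le_trans (entry_norm_le _ _ _) (FC z Kz p).
Qed.

Lemma dominated_mx a b (F : V -> P -> 'M[R]_(a, b)) w :
  (forall p, 0 <= w p) -> (forall i j, dominated (fun z p => F z p i j) w) ->
  dominated F w.
Proof.
move=> w0 FC.
have -> : F = fun z p => \sum_i \sum_j F z p i j *: delta_mx i j.
  by apply/funext => z; apply/funext => p; exact: matrix_sum_delta.
do 2![apply: dominated_sum => // ?]; apply: dominated_weightM1.
by apply: dominatedZ => //; exact: dominated_cst.
Qed.

Lemma dominated_trmx a b (F : V -> P -> 'M[R]_(a, b)) w :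
  dominated F w -> dominated (fun z p => (F z p)^T) w.
Proof. by move=> [C C0 FC]; exists C => // z Kz p; rewrite norm_trmx FC. Qed.

Lemma dominated_mulmx a b c (F : V -> P -> 'M[R]_(a, b))
    (G : V -> P -> 'M[R]_(b, c)) w w' :
  dominated F w -> dominated G w' ->
  dominated (fun z p => F z p *m G z p) (fun p => w p * w' p).
Proof.
move=> [C C0 FC] [D D0 GD]; exists (b%:R * (C * D)) => [|z Kz p].
  by rewrite !mulr_ge0.
rewrite (le_trans (norm_mulmx_le _ _))// -mulrA ler_wpM2l// mulrACA.
by rewrite ler_pM ?FC ?GD.
Qed.

Lemma dominated_dot (x y : V -> P -> V) w w' :
  dominated x w -> dominated y w' ->
  dominated (fun z p => dot (x z p) (y z p)) (fun p => w p * w' p).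
Proof.
by move=> dx dy; apply/dominated_entry/dominated_mulmx => //; exact: dominated_trmx.
Qed.

(** In coordinates the derivative is a sum of components of the direction
    times partial derivatives, the latter being bounded on [K]. *)
Lemma dominated_derive (W : normedModType R) U (F : V -> W)
    (x : V -> P -> V) w :
  compact K -> K `<=` U -> Ck 1 U F -> (forall p, 0 <= w p) ->
  dominated x w -> dominated (fun z p => 'D_(x z p) F z) w.
Proof.
move=> cK KU [dF cF] w0 dx.
apply: (eq_dominated (F := fun z p =>
    \sum_i x z p i 0 *: 'D_(delta_mx i 0 : V) F z)) => [z Kz p|].
  by rewrite derive_coord//; exact/dF/KU.
apply: dominated_sum => // i; apply: dominated_weightM1.
apply: dominatedZ; first exact: dominated_entry.
by apply: dominated_continuous => // z /set_mem/KU; exact: cF.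
Qed.

Lemma dominated_D2 U (M : V -> 'M[R]_n) (x y : V -> P -> V) w w' :
  compact K -> open U -> K `<=` U -> Ck 2 U M ->
  (forall p, 0 <= w p) -> (forall p, 0 <= w' p) ->
  dominated x w -> dominated y w' ->
  dominated (fun z p => D2 M z (x z p) (y z p)) (fun p => w p * w' p).
Proof.
move=> cK oU KU CM w0 w'0 dx dy.
apply: (eq_dominated (F := fun z p => \sum_i \sum_j
    (x z p i 0 * y z p j 0) *: D2 M z (delta_mx i 0) (delta_mx j 0))).
  by move=> z Kz p; rewrite (D2_coord _ _ oU CM)//; exact: KU.
do 2![apply: dominated_sum => [p|?]; first exact: mulr_ge0].
apply: dominated_weightM1; apply: dominatedZ.
  by apply: dominatedZ; exact: dominated_entry.
apply: dominated_continuous => // z /set_mem/KU/mem_set Uz.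
exact: (Ck_continuous (k := 0) ((CM.2 _).2 _)).
Qed.

Lemma dominated_hessian U (g : V -> R) :
  compact K -> K `<=` U -> Ck 2 U g ->
  dominated (fun z _ => hessian g z) (fun=> 1).
Proof.
move=> cK KU Cg; apply: dominated_mx => // i j.
apply: (eq_dominated (F := fun z _ =>
    'D_(delta_mx j 0) ('D_(delta_mx i 0) g) z)) => [z _ p|].
  by rewrite hessianE.
apply: dominated_continuous => // z /set_mem/KU/mem_set.
exact: (Ck_continuous (k := 0) ((Cg.2 _).2 _)).
Qed.

Lemma dominated_derive_hessian U (g : V -> R) (x : V -> P -> V) w :
  compact K -> K `<=` U -> Ck 3 U g -> (forall p, 0 <= w p) ->
  dominated x w -> dominated (fun z p => 'D_(x z p) (hessian g) z) w.
Proof.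
move=> cK KU Cg w0 dx; apply: dominated_mx => // i j.
apply: (eq_dominated (F := fun z p => 'D_(x z p)
    ('D_(delta_mx j 0) ('D_(delta_mx i 0) g)) z)).
  move=> z Kz p; rewrite derive_mx; last exact/(derivable_hessian Cg)/KU.
  rewrite mxE.
  exact: (congr1 (fun F => 'D_(x z p) F z) (esym (hessian_entryE g i j))).
by apply: (dominated_derive _ KU) => //; exact: (Cg.2 _).2.
Qed.

End Domination.

(** * Uniform strict concavity *)

Section UniformEllipticity.
Context {R : realType} {n : nat}.
Local Notation V := 'cV[R]_n.

Lemma dotN (x y : V) : dot x (- y) = - dot x y.
Proof. by rewrite /dot mulmxN mxE. Qed.

Lemma dotD (x y z : V) : dot x (y + z) = dot x y + dot x z.
Proof. by rewrite /dot mulmxDr mxE. Qed.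

Lemma dotZ (x y : V) (a : R) : dot x (a *: y) = a * dot x y.
Proof. by rewrite /dot -scalemxAr mxE. Qed.

(** The form [- v^T D^2 M(z)[x, x] v] is quadratic in [v] and in [x]
    separately.  [uniform_posdef], with the pairs of a point and a unit
    direction as parameters, treats unit [x]; homogeneity does the rest. *)
Lemma uniform_negdef_D2 (K U : set V) (M : V -> 'M[R]_n) :
  compact K -> open U -> K `<=` U -> Ck 2 U M ->
  (forall z, K z -> forall x, x != 0 -> negdef (D2 M z x x)) ->
  exists2 c, 0 < c & forall z, K z -> forall x v,
    c * (`|v| * `|x|) ^+ 2 <= - dot v (D2 M z x x *m v).
Proof.
move=> cK oU KU CM negM.
(* The coordinate sum makes the joint continuity in (z, x) visible. *)
pose Q (p : V * V) : 'M[R]_n := - \sum_i \sum_j (p.2 i 0 * p.2 j 0) *: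
    D2 M p.1 (delta_mx i 0) (delta_mx j 0).
have QE z x : K z -> Q (z, x) = - D2 M z x x.
  by move=> Kz; rewrite (D2_coord x x oU CM)//; exact: KU.
have [p|[z x] [/= Kz x1] v v0|c c0 cQ] :=
    uniform_posdef (Q := Q) (compact_setX cK compact_sphere).
- rewrite inE => -[Kp p1]; apply: cvgN.
  have cfst : q.1 @[q --> p] --> p.1 by exact: cvg_fst.
  have csnd (i : 'I_n) : (q.2 : V) i 0 @[q --> p] --> (p.2 : V) i 0.
    have c2 : q.2 @[q --> p] --> p.2 by exact: cvg_snd.
    exact: (cvg_mxP _ _).1 c2 _ _.
  apply: cvg_sumv => i; apply: cvg_sumv => j; apply: cvgZ; first exact: cvgM.
  apply: (cvg_comp _ (fun z => D2 M z (delta_mx i 0) (delta_mx j 0)) cfst).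
  by apply: (Ck_continuous (k := 0) ((CM.2 _).2 _)); apply/mem_set/KU.
- rewrite QE// mulNmx dotN oppr_gt0; apply: negM => //.
  by rewrite -normr_gt0 x1.
exists c => // z Kz x v; have [->|x0] := eqVneq x 0.
  rewrite normr0 mulr0 expr0n/= mulr0 (D2_coord _ _ oU CM); last exact: KU.
  rewrite big1 => [|i _]; first by rewrite mul0mx /dot mulmx0 mxE oppr0.
  by rewrite big1// => j _; rewrite mxE mul0r scale0r.
have x_gt0 : 0 < `|x| by rewrite normr_gt0.
pose y := `|x|^-1 *: x.
have y1 : `|y| = 1 by rewrite normrZ normfV normr_id mulVf ?gt_eqF.
have Dxy : D2 M z x x = `|x| ^+ 2 *: D2 M z y y.
  rewrite !(D2_coord _ _ oU CM) ?scaler_sumr; try exact: KU.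
  apply: eq_bigr => i _; rewrite scaler_sumr; apply: eq_bigr => j _.
  by rewrite scalerA !mxE; congr (_ *: _); field; rewrite gt_eqF.
have := cQ (z, y) (conj Kz y1) v.
rewrite QE// mulNmx dotN => cy; rewrite Dxy -scalemxAl dotZ -mulrN exprMn.
by rewrite mulrA [leLHS]mulrC ler_pM2l// exprn_gt0.
Qed.

End UniformEllipticity.

(** * The McCann expression *)

Section McCannForm.
Context {R : realType} {n : nat}.
Local Notation V := 'cV[R]_n.

Lemma mulmx_inv_comb (A B : 'M[R]_n) (a e : R) : A \in unitmx ->
  invmx A *m (a *: A + e *: B) = a%:M + e *: (invmx A *m B).
Proof. by move=> uA; rewrite mulmxDr -!scalemxAr mulVmx// scalemx1. Qed.

(** The right-hand side of the generalized McCann condition at a fixed point.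
    The first and second derivatives enter as arbitrary maps, so that the same
    formula can be used with [L] and with its perturbation [N]. *)
Definition mccann_form (D2z : V -> V -> 'M[R]_n) (DM DL : V -> 'M[R]_n)
    (Mz Lz : 'M[R]_n) (v x b : V) : R :=
  - 2%:R^-1 * dot v (D2z x (Lz *m x) *m v)
  + dot b (Lz *m Mz *m b)
  + dot b ((Lz *m DM x - DM (Lz *m x)) *m v)
  + dot v (DL x *m (DM x *m v + Mz *m b))
  - dot v (DL (DM x *m v + Mz *m b) *m x).

(** The contribution of [a%:M] to the commutator term
    [Lz *m DM x - DM (Lz *m x)] cancels by linearity of [DM]. *)
Lemma mccann_form_affine D2z DM DN Mz Nz v x b (a e : R) :
  (forall y, D2z x (a *: x + e *: y) = a *: D2z x x + e *: D2z x y) ->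
  (forall y, DM (a *: x + e *: y) = a *: DM x + e *: DM y) ->
  mccann_form D2z DM (fun y => e *: DN y) Mz (a%:M + e *: Nz) v x b =
  a * (- 2%:R^-1 * dot v (D2z x x *m v) + dot b (Mz *m b))
  + e * mccann_form D2z DM DN Mz Nz v x b.
Proof.
move=> linD2 linDM.
rewrite /mccann_form !mulmxDl !mul_scalar_mx -!scalemxAl linD2 linDM.
rewrite !mulNmx !mulmxDl -!scalemxAl !dotD !dotN !dotD !dotZ; ring.
Qed.

(** The constant part [a%:M] of [L] is invisible to its derivative.  The
    decomposition of [L] is only asked for near [z], which allows [N] to be
    replaced by zero away from the support of [g]. *)
Lemma mccann_form_perturbation U (M L N : V -> 'M[R]_n) z v x b (a e : R) :
  differentiable M z -> differentiable ('D_x M) z ->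
  open U -> U z -> (forall w, U w -> L w = a%:M + e *: N w) ->
  (forall y, derivable N z y) ->
  mccann_form (D2 M z) (fun y => 'D_y M z) (fun y => 'D_y L z) (M z) (L z) v x b
  = a * (- 2%:R^-1 * dot v (D2 M z x x *m v) + dot b (M z *m b))
    + e * mccann_form (D2 M z) (fun y => 'D_y M z) (fun y => 'D_y N z)
            (M z) (N z) v x b.
Proof.
move=> dM dDM oU Uz LE dN.
have -> : (fun y => 'D_y L z) = (fun y => e *: 'D_y N z).
  apply/funext => y; rewrite (open_eq_derive y oU Uz LE).
  rewrite -[fun w => _]/(cst a%:M + e *: N) deriveD//; last exact: derivableZ.
  by rewrite derive_cst add0r deriveZ.
by rewrite LE//; apply: mccann_form_affine => y; exact: derive_linear.
Qed.

(** Let [v, x, b] be the components of [p], [s = |v| |x|] and [r = |b|].  The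
    five terms are of orders [s^2], [r^2], [r s], [s (s + r)] and [s (s + r)],
    all at most [(s + r)^2]. *)
Lemma dominated_mccann_form (K U : set V) (M : V -> 'M[R]_n) (g : V -> R) :
  compact K -> open U -> K `<=` U -> Ck 2 U M -> Ck 3 U g ->
  let N z := M z *m hessian g z in
  dominated K (fun z (p : V * V * V) =>
      mccann_form (D2 M z) (fun y => 'D_y M z) (fun y => 'D_y N z) (M z) (N z)
        p.1.1 p.1.2 p.2)
    (fun p => (`|p.1.1| * `|p.1.2| + `|p.2|) ^+ 2).
Proof.
move=> cK oU KU CM Cg N.
set W := fun p : V * V * V => _.
have inU (W' : normedModType R) k (F : V -> W') :
    Ck k U F -> {in K, continuous F}.
  by move=> /Ck_continuous cF z /set_mem/KU/mem_set; exact: cF.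
pose V3 := (V * V * V)%type.
pose wv (p : V3) := `|p.1.1|; pose wx (p : V3) := `|p.1.2|.
(* wu weighs the vector DM[x] v + M b that occurs in the last two terms. *)
pose wb (p : V3) := `|p.2|; pose wu p := wv p * wx p + wb p.
have dom_id (y : V3 -> V) : dominated K (fun _ p => y p) (fun p => `|y p|).
  by exists 1 => // z _ p; rewrite mul1r.
have dv : dominated K (fun _ (p : V3) => p.1.1) wv by exact: dom_id.
have dx : dominated K (fun _ (p : V3) => p.1.2) wx by exact: dom_id.
have db : dominated K (fun _ (p : V3) => p.2) wb by exact: dom_id.
have dM : dominated K (fun z (_ : V3) => M z) (fun=> 1).
  exact/dominated_continuous/(inU _ _ _ CM).
have dH : dominated K (fun z (_ : V3) => hessian g z) (fun=> 1).
  exact: (dominated_hessian cK KU (CkW Cg)).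
have dN : dominated K (fun z (_ : V3) => N z) (fun=> 1).
  by apply: dominated_weightM1; exact: dominated_mulmx.
have dDM (y : V -> V3 -> V) w : (forall p, 0 <= w p) ->
    dominated K y w -> dominated K (fun z p => 'D_(y z p) M z) w.
  by move=> w0; apply: (dominated_derive cK KU) => //; exact: CkW.
have dDN (y : V -> V3 -> V) w : (forall p, 0 <= w p) ->
    dominated K y w -> dominated K (fun z p => 'D_(y z p) N z) w.
  move=> w0 dy; apply: (eq_dominated (F := fun z p =>
    'D_(y z p) M z *m hessian g z + M z *m 'D_(y z p) (hessian g) z)).
    move=> z /KU Uz p; apply/esym/derive_val.
    apply: is_derive_mulmx; first exact: (Ck_derivable CM).
    exact: (derivable_hessian Cg).
  apply: dominatedD.
    by apply: dominated_weightM1; apply: dominated_mulmx => //; exact: dDM.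
  apply: dominated_weight1M; apply: dominated_mulmx => //.
  exact: (dominated_derive_hessian cK KU).
have [v0 x0 b0] : [/\ forall p, 0 <= wv p, forall p, 0 <= wx p &
  forall p, 0 <= wb p] by split=> p; exact: normr_ge0.
have u0 p : 0 <= wu p by rewrite addr_ge0// mulr_ge0.
have wW w : (forall p, w p <= wu p ^+ 2) -> forall F : V -> V3 -> R,
    dominated K F w -> dominated K F W.
  by move=> wu2 F; exact: dominated_le.
have dNx : dominated K (fun z (p : V3) => N z *m p.1.2) wx.
  by apply: dominated_weight1M; exact: dominated_mulmx.
have dy : dominated K (fun z (p : V3) => 'D_p.1.2 M z *m p.1.1 + M z *m p.2) wu.
  apply: dominatedD.
    apply: (@dominated_le _ _ _ _ _ _ (fun p => wx p * wv p)).
      by move=> p; rewrite mulrC lerDl.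
    by apply: dominated_mulmx => //; exact: dDM.
  apply: (@dominated_le _ _ _ _ _ _ (fun p => 1 * wb p)).
    by move=> p; rewrite mul1r lerDr mulr_ge0.
  exact: dominated_mulmx.
have vx0 p : 0 <= wv p * wx p by rewrite mulr_ge0.
do 4?apply: dominatedD.
- apply: (wW (fun p => 1 * (wv p * (wx p * wx p * wv p)))).
    by move=> p; have := vx0 p; have := b0 p; rewrite /wu; nra.
  apply: dominatedZ; first exact: dominated_cst.
  apply: dominated_dot => //; apply: dominated_mulmx => //.
  exact: (dominated_D2 cK oU KU CM).
- apply: (wW (fun p => wb p * (1 * 1 * wb p))).
    by move=> p; have := vx0 p; have := b0 p; rewrite /wu; nra.
  apply: dominated_dot => //; apply: dominated_mulmx => //.
  exact: dominated_mulmx.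
- apply: (wW (fun p => wb p * (wx p * wv p))).
    by move=> p; have := vx0 p; have := b0 p; rewrite /wu; nra.
  apply: dominated_dot => //; apply: dominated_mulmx => //.
  apply: dominatedD; last by apply: dominatedN; exact: dDM.
  apply: dominated_weight1M; apply: dominated_mulmx => //; exact: dDM.
- apply: (wW (fun p => wv p * (wx p * wu p))).
    by move=> p; have := vx0 p; have := b0 p; rewrite /wu; nra.
  apply: dominated_dot => //; apply: dominated_mulmx => //; exact: dDN.
- apply: (wW (fun p => wv p * (wu p * wx p))).
    by move=> p; have := vx0 p; have := b0 p; rewrite /wu; nra.
  apply: dominatedN; apply: dominated_dot => //; apply: dominated_mulmx => //.
  exact: dDN.
Qed.

End McCannForm.

(** * The generalized McCann condition *)

Theorem proposition5p5 (R : realType) (n : nat) (S : set 'cV[R]_n)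
    (S_convex : convex_set S) (S_compact : compact S) (S_int : S° !=set0)
    (M : 'cV[R]_n -> 'M[R]_n)
    (M0 : condC0 S M) (M1 : condC1 S M) (M2 : condC2 S M) (M3 : condC3 S M)
    (M2' : condC2' S M)
    (alpha : R) (alpha_gt0 : 0 < alpha)
    (g : 'cV[R]_n -> R) (g_Cc : smooth_compact_support S° g) :
  exists eps0 : R, 0 < eps0 /\
    forall h : 'cV[R]_n -> R, Ck 2 S° h -> induced_by S M h ->
    forall eps : R, 0 < eps -> eps < eps0 ->
    let f := fun z => alpha * h z + eps * g z in
    let L := fun z => M z *m hessian f z in
    generalized_mccann S M L.
Proof.
have oU : open S° := open_interior _.
have CM : Ck 2 S° M by exact: M0.2.
have [Cg cK KU] := g_Cc.
set K := closure _ in cK KU.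
pose N z := M z *m hessian g z.
pose form z (p : 'cV[R]_n * 'cV[R]_n * 'cV[R]_n) :=
  mccann_form (D2 M z) (fun y => 'D_y M z) (fun y => 'D_y N z) (M z) (N z)
    p.1.1 p.1.2 p.2.
have [C C0 form_le] : dominated K form
    (fun p => (`|p.1.1| * `|p.1.2| + `|p.2|) ^+ 2).
  exact: (dominated_mccann_form cK oU KU CM (Cg 3)).
have [c1 c1_gt0 M_ge] : exists2 c, 0 < c &
    forall z, K z -> forall b, c * `|b| ^+ 2 <= dot b (M z *m b).
  apply: (uniform_posdef cK) => [z /set_mem/KU/mem_set|z /KU Uz].
    exact: (Ck_continuous CM).
  exact: (M1 z Uz).2.
have [c2 c2_gt0 D2M_le] : exists2 c, 0 < c & forall z, K z -> forall x v,
    c * (`|v| * `|x|) ^+ 2 <= - dot v (D2 M z x x *m v).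
  by apply: (uniform_negdef_D2 cK oU KU CM) => z /KU Uz; exact: M2'.
pose c := Num.min c1 (c2 / 2).
have c_gt0 : 0 < c by rewrite lt_min c1_gt0 divr_gt0.
have [c_c1 c_c2] : c <= c1 /\ c <= c2 / 2 by rewrite !ge_min !lexx orbT.
(* The factor 2 absorbs (s + r)^2 <= 2 (s^2 + r^2); C + 1 replaces C to keep
   the denominator positive. *)
exists (alpha * c / (2 * (C + 1))); split.
  by rewrite divr_gt0 ?mulr_gt0// ltr_wpDl.
move=> h Ch Mh eps eps_gt0 eps_lt f L z Uz v x b.
have LE w : S° w -> L w = alpha%:M + eps *: N w.
  move=> Uw; rewrite /L /f (hessian_comb _ _ oU Ch (Cg 2) Uw) /N.
  by have [hu ->] := Mh w Uw; exact: mulmx_inv_comb.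
have q0_le_0 : 0 <= - 2%:R^-1 * dot v (D2 M z x x *m v) + dot b (M z *m b).
  rewrite addr_ge0 ?mulNr ?oppr_ge0 ?mulr_ge0_le0 ?invr_ge0//; first exact: M2.
  have [->|b0] := eqVneq b 0; first by rewrite mulmx0 /dot mulmx0 mxE.
  by apply/ltW; exact: (M1 z Uz).2.
have dN y : derivable N z y.
  have [] // : is_derive z y N ('D_y M z *m hessian g z + M z *m 'D_y (hessian g) z).
  apply: is_derive_mulmx; first exact: (Ck_derivable CM Uz).
  exact: (derivable_hessian (Cg 3) Uz).
suff : 0 <= mccann_form (D2 M z) (fun y => 'D_y M z) (fun y => 'D_y L z)
               (M z) (L z) v x b by [].
have dM : differentiable M z := CM.1 z Uz.
have dDM : differentiable ('D_x M) z := (CM.2 x).1 z Uz.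
have [Kz|Kz] := pselect (K z); last first.
  have oUK : open (S° `&` ~` K).
    by apply: openI => //; exact/closed_openC/closed_closure.
  have g0 w : (S° `&` ~` K) w -> g w = 0.
    move=> [Uw Kw]; apply/eqP; apply: contrapT => gw; apply: Kw.
    by apply: subset_closure; split=> //; exact/negP.
  have LE0 w : (S° `&` ~` K) w -> L w = alpha%:M + 0 *: cst 0 w.
    move=> UKw; rewrite LE; last exact: UKw.1.
    by rewrite /N (hessian_eq0 oUK UKw g0) mulmx0 !scaler0.
  have -> := mccann_form_perturbation v b dM dDM oUK (conj Uz Kz) LE0
    (fun y => derivable_cst 0 z y).
  by rewrite mul0r addr0 mulr_ge0// ltW.
rewrite (mccann_form_perturbation v b dM dDM oU Uz LE dN).
have := form_le z Kz (v, x, b); rewrite /= => /ler_normlP[+ _].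
have := M_ge z Kz b; have := D2M_le z Kz x v.
rewrite -[X in eps * X]/(form z (v, x, b)).
move: (form _ _) (dot v _) (dot b _) (`|v| * `|x|) `|b| => F d2 d0 s r.
move=> d2_ge d0_ge F_ge.
rewrite ltr_pdivlMr in eps_lt; last by rewrite mulr_gt0// ltr_wpDl.
have q0_ge : c * (s ^+ 2 + r ^+ 2) <= - 2^-1 * d2 + d0.
  have := ler_wpM2r (sqr_ge0 s) c_c2; have := ler_wpM2r (sqr_ge0 r) c_c1; lra.
have {}F_ge : - (2 * (C + 1) * (s ^+ 2 + r ^+ 2)) <= F.
  have W_le : C * (s + r) ^+ 2 <= (C + 1) * (2 * (s ^+ 2 + r ^+ 2)).
    apply: ler_pM => //; [exact: sqr_ge0|by rewrite lerDl|].
    by have := sqr_ge0 (s - r); lra.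
  lra.
have W0 : 0 <= s ^+ 2 + r ^+ 2 by rewrite addr_ge0 ?sqr_ge0.
have := ler_wpM2l (ltW alpha_gt0) q0_ge; have := ler_wpM2l (ltW eps_gt0) F_ge.
have := ler_wpM2r W0 (ltW eps_lt); lra.
Qed.
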